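(* Let $\mathbb{X}^2$ be one of the Euclidean plane $\mathbb{E}^2$, the unit sphere $\mathbb{S}^2$, or the hyperbolic plane $\mathbb{H}^2$ (of curvature $0$, $1$, $-1$ respectively), with the associated functions $\mathfrak{s}$ and $\mathfrak{c}$ (that is, $(\mathfrak{s}(d),\mathfrak{c}(d))$ equals $(d,1)$ if $\mathbb{X}^2=\mathbb{E}^2$, $(\sin d,\cos d)$ if $\mathbb{X}^2=\mathbb{S}^2$, and $(\sinh d,\cosh d)$ if $\mathbb{X}^2=\mathbb{H}^2$). Let $\triangle \mathrm{ABC}$ be a triangle on $\mathbb{X}^2$ with vertices $\mathrm{A},\mathrm{B},\mathrm{C}$, internal angles $A,B,C$ at $\mathrm{A},\mathrm{B},\mathrm{C}$ respectively, and side lengths $a,b,c$, where $a,b,c$ are the lengths of the sides opposite $\mathrm{A},\mathrm{B},\mathrm{C}$ respectively. Define $$t_{a,b;c} := \frac{\mathfrak{c}(a)+\mathfrak{c}(b)}{1+\mathfrak{c}(c)},\qquad t_{b,c;a} := \frac{\mathfrak{c}(b)+\mathfrak{c}(c)}{1+\mathfrak{c}(a)},\qquad t_{c,a;b} := \frac{\mathfrak{c}(c)+\mathfrak{c}(a)}{1+\mathfrak{c}(b)}.$$ Then the following hold. (Law of cosines) $$t_{b,c;a}\,\mathfrak{s}(a)^2 = t_{c,a;b}\,\mathfrak{s}(b)^2 + t_{a,b;c}\,\mathfrak{s}(c)^2 - 2\,\mathfrak{s}(b)\,\mathfrak{s}(c)\cos A;$$ $$t_{c,a;b}\,\mathfrak{s}(b)^2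 = t_{a,b;c}\,\mathfrak{s}(c)^2 + t_{b,c;a}\,\mathfrak{s}(a)^2 - 2\,\mathfrak{s}(c)\,\mathfrak{s}(a)\cos B;$$ $$t_{a,b;c}\,\mathfrak{s}(c)^2 = t_{b,c;a}\,\mathfrak{s}(a)^2 + t_{c,a;b}\,\mathfrak{s}(b)^2 - 2\,\mathfrak{s}(a)\,\mathfrak{s}(b)\cos C.$$ (Pythagorean theorem) If the angle $A$ is the right angle, i.e. $A=\pi/2$, then $$t_{b,c;a}\,\mathfrak{s}(a)^2 = t_{c,a;b}\,\mathfrak{s}(b)^2 + t_{a,b;c}\,\mathfrak{s}(c)^2.$$
   Context: The three geometries are realized in $\mathbb{R}^3$ as $$\mathbb{E}^2=\{(x,y,z)\in\mathbb{R}^3 : z=1\},\quad \mathbb{S}^2=\{(x,y,z)\in\mathbb{R}^3 : x^2+y^2+z^2=1\},\quad \mathbb{H}^2=\{(x,y,z)\in\mathbb{R}^3 : x^2+y^2-z^2=-1,\ z>0\}.$$ The distance on $\mathbb{E}^2$ is the Euclidean distance; the distance $d$ between $(p_1,p_2,p_3)$ and $(q_1,q_2,q_3)$ is given on $\mathbb{S}^2$ by $\cos d = p_1q_1+p_2q_2+p_3q_3$ with $d\in[0,\pi]$, and on $\mathbb{H}^2$ by $\cosh d = -p_1q_1-p_2q_2+p_3q_3$ with $d\ge 0$. A triangle is meant in the usual sense: three vertices not lying on a common line (geodesic; a great circle in $\mathbb{S}^2$), joined pairwise by the shortest geodesic segments. Side lengths are the distances between the vertices (so on $\mathbb{S}^2$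 they lie in $(0,\pi)$), and the internal angle at a vertex is the angle in $(0,\pi)$ between the two sides meeting there. The generalised trigonometric functions are, for a real constant $K$, $$\mathfrak{s}(d)=\sum_{i=0}^{\infty}\frac{(-K)^i d^{2i+1}}{(2i+1)!},\qquad \mathfrak{c}(d)=\sum_{i=0}^{\infty}\frac{(-K)^i d^{2i}}{(2i)!},$$ with $K=0$ for $\mathbb{E}^2$, $K=1$ for $\mathbb{S}^2$, $K=-1$ for $\mathbb{H}^2$. Thus $\mathfrak{s}(d)=d,\ \sin d,\ \sinh d$ and $\mathfrak{c}(d)=1,\ \cos d,\ \cosh d$ for $\mathbb{E}^2,\mathbb{S}^2,\mathbb{H}^2$ respectively. The notation $\mathfrak{s}(d)^2$ means $(\mathfrak{s}(d))^2$. *)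

(* Defs.v *)
(* Stdlib's real numbers with Coquelicot. *)
From Stdlib Require Import Reals Factorial.
From Coquelicot Require Import Coquelicot.
Open Scope R_scope.

Inductive geometry := Euclidean | Spherical | Hyperbolic.

Definition curvature (X : geometry) : R :=
  match X with Euclidean => 0 | Spherical => 1 | Hyperbolic => -1 end.

Definition gen_sin (X : geometry) (d : R) : R :=
  Series (fun i => (- curvature X) ^ i * d ^ (2 * i + 1)
                   / INR (fact (2 * i + 1))).

Definition gen_cos (X : geometry) (d : R) : R :=
  Series (fun i => (- curvature X) ^ i * d ^ (2 * i) / INR (fact (2 * i))).

(* [t_coef X a b c] is t_{a,b;c}. *)
Definition t_coef (X : geometry) (a b c : R) : R :=
  (gen_cos X a + gen_cos X b) / (1 + gen_cos X c).

Definition point : Type := (R * R * R)%type.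

Definition dot (p q : point) : R :=
  let '(p1, p2, p3) := p in let '(q1, q2, q3) := q in
  p1 * q1 + p2 * q2 + p3 * q3.

Definition lorentz (p q : point) : R :=
  let '(p1, p2, p3) := p in let '(q1, q2, q3) := q in
  p1 * q1 + p2 * q2 - p3 * q3.

Definition on_space (X : geometry) (p : point) : Prop :=
  let '(x, y, z) := p in
  match X with
  | Euclidean => z = 1
  | Spherical => x ^ 2 + y ^ 2 + z ^ 2 = 1
  | Hyperbolic => x ^ 2 + y ^ 2 - z ^ 2 = -1 /\ 0 < z
  end.

(* [d] is the distance between [p] and [q]; for points of the space there is
   exactly one such [d]. *)
Definition is_distance (X : geometry) (p q : point) (d : R) : Prop :=
  let '(p1, p2, p3) := p in let '(q1, q2, q3) := q in
  match X with
  | Euclidean => d = sqrt ((p1 - q1) ^ 2 + (p2 - q2) ^ 2 + (p3 - q3) ^ 2)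
  | Spherical => 0 <= d <= PI /\ cos d = p1 * q1 + p2 * q2 + p3 * q3
  | Hyperbolic => 0 <= d /\ cosh d = - p1 * q1 - p2 * q2 + p3 * q3
  end.

(* In each of the three models, the geodesic lines are the intersections of the
   space with the planes through the origin that meet it in more than one
   point; [n] is a normal vector of such a plane. *)
Definition collinear (p q r : point) : Prop :=
  exists n : point, n <> (0, 0, 0) /\ dot n p = 0 /\ dot n q = 0 /\ dot n r = 0.

Definition is_triangle (X : geometry) (p q r : point) : Prop :=
  on_space X p /\ on_space X q /\ on_space X r /\ ~ collinear p q r.

(* [g], restricted to [0, L], is a shortest geodesic segment from [p] to [q]
   parametrised by arc length, i.e. an isometric embedding of [0, L]. *)
Definition is_segment (X : geometry) (p q : point) (L : R) (g : R -> point) :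
    Prop :=
  0 <= L /\ g 0 = p /\ g L = q /\
  (forall t, 0 <= t <= L -> on_space X (g t)) /\
  (forall t t', 0 <= t <= L -> 0 <= t' <= L ->
     is_distance X (g t) (g t') (Rabs (t - t'))).

(* One-sided derivative at 0, since [g] is only constrained on [0, L]. *)
Definition initial_velocity (g : R -> point) (u : point) : Prop :=
  filterlim (fun t : R => scal (/ t) (minus (g t) (g 0)))
    (at_right 0) (locally u).

(* The Riemannian metric on tangent vectors induced by the ambient form. *)
Definition metric (X : geometry) (u v : point) : R :=
  match X with Euclidean | Spherical => dot u v | Hyperbolic => lorentz u v end.

(* [theta] is the angle at [p] between the sides [p q] and [p r]. *)
Definition is_angle (X : geometry) (p q r : point) (theta : R) : Prop :=
  exists (L M : R) (g h : R -> point) (u v : point),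
    is_segment X p q L g /\ is_segment X p r M h /\
    initial_velocity g u /\ initial_velocity h v /\
    0 < theta < PI /\
    cos theta = metric X u v / (sqrt (metric X u u) * sqrt (metric X v v)).

(* Main.v *)
(** Write [k] for the curvature, [s] and [c] for the generalised sine and cosine.
    An arc-length segment of length [L] from [p] to [q] is forced to be
    [t |-> (s (L - t) p + s t q) / s L]: when [k <> 0], both points lie on the
    quadric [<x, x> = k] and their product is also [k], so that they coincide.
    Hence the initial velocity is [(q - c L p) / s L], a unit vector, and the
    product of two such vectors gives, for [k <> 0], the classical law of cosines
    [s b * s c * cos A = k (c a - c b * c c)]. Together with
    [s x ^ 2 = k (1 - c x) (1 + c x)], this turns the unified law into a
    polynomial identity once the denominators [1 + c x] cancel; they are nonzero
    because two vertices of a triangle are never antipodal. When [k = 0], every [t]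
    coefficient is [1], and the dot product of the velocities gives the law. *)

Require Import Defs.
From Stdlib Require Import Reals Lra Factorial.
From Coquelicot Require Import Coquelicot.
Open Scope R_scope.

(** * Closed forms of the generalised sine and cosine *)

Lemma Series_single (u : nat -> R) :
  (forall n, u (S n) = 0) -> Series u = u O.
Proof.
intros Hu; apply is_series_unique, filterlim_ext with (fun _ : nat => u O).
- intro n; induction n as [|n IH].
  + now rewrite sum_O.
  + rewrite sum_Sn, <- IH, Hu; unfold plus; simpl; ring.
- apply filterlim_const.
Qed.

(* [cos_in] and [sin_in] are power series in the square of the argument, and
   the library proves them convergent for negative values too: this covers the
   hyperbolic functions. *)
Lemma cosh_sinh_series (d lc ls : R) :
  cos_in (- d ^ 2) lc -> sin_in (- d ^ 2) ls -> cosh d = lc /\ sinh d = d * ls.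
Proof.
intros Hc Hs.
(* The exponential series splits into even and odd terms, which depend on [x] only through [x ^ 2]
   apart from one factor [x]. Hence the same [lc] and [ls] serve for [d] and [- d]. *)
assert (H : forall x, x ^ 2 = d ^ 2 -> exp x = lc + x * ls).
{ intros x Hx.
  pose proof (is_exp_Reals x) as He.
  apply is_pseries_unique in He; rewrite <- He.
  apply is_pseries_unique, is_pseries_odd_even; rewrite Hx.
  - apply is_pseries_R; apply is_series_Reals in Hc; revert Hc; apply is_series_ext; intro n.
    unfold cos_n; simpl.
    replace (- (d * (d * 1))) with (-1 * (d * (d * 1))) by ring.
    rewrite Rpow_mult_distr; unfold Rdiv.
    transitivity (((-1) ^ n * (-1) ^ n) * ((d * (d * 1)) ^ n
      * / INR (fact (n + (n + 0))))); [ring|].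
    rewrite <- Rpow_mult_distr; replace (-1 * -1) with 1 by ring.
    rewrite pow1; ring.
  - apply is_pseries_R; apply is_series_Reals in Hs; revert Hs; apply is_series_ext; intro n.
    unfold sin_n; simpl.
    replace (- (d * (d * 1))) with (-1 * (d * (d * 1))) by ring.
    rewrite Rpow_mult_distr; unfold Rdiv.
    transitivity (((-1) ^ n * (-1) ^ n) * ((d * (d * 1)) ^ n
      * / INR (fact (n + (n + 0) + 1)))); [ring|].
    rewrite <- Rpow_mult_distr; replace (-1 * -1) with 1 by ring.
    rewrite pow1; ring. }
unfold cosh, sinh; rewrite (H d), (H (- d)) by ring; split; field.
Qed.

Lemma gen_cos_euclidean (d : R) : gen_cos Euclidean d = 1.
Proof.
unfold gen_cos; rewrite Series_single.
- simpl; field.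
- intro n; simpl; rewrite Ropp_0; unfold Rdiv; ring.
Qed.

Lemma gen_sin_euclidean (d : R) : gen_sin Euclidean d = d.
Proof.
unfold gen_sin; rewrite Series_single.
- simpl; field.
- intro n; simpl; rewrite Ropp_0; unfold Rdiv; ring.
Qed.

Lemma gen_cos_spherical (d : R) : gen_cos Spherical d = cos d.
Proof.
unfold gen_cos, cos; destruct (exist_cos (Rsqr d)) as [l Hl].
apply is_series_Reals in Hl; rewrite <- (is_series_unique _ _ Hl).
apply Series_ext; intro n.
unfold cos_n; rewrite pow_mult, Rsqr_pow2; simpl curvature.
replace (- (1)) with (-1) by ring; unfold Rdiv; ring.
Qed.

Lemma gen_sin_spherical (d : R) : gen_sin Spherical d = sin d.
Proof.
unfold gen_sin, sin; destruct (exist_sin (Rsqr d)) as [l Hl].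
apply is_series_Reals in Hl; rewrite <- (is_series_unique _ _ Hl), <- Series_scal_l.
apply Series_ext; intro n.
unfold sin_n; rewrite pow_add, pow_mult, Rsqr_pow2, pow_1; simpl curvature.
replace (- (1)) with (-1) by ring; unfold Rdiv; ring.
Qed.

Lemma gen_cos_hyperbolic (d : R) : gen_cos Hyperbolic d = cosh d.
Proof.
destruct (exist_cos (- d ^ 2)) as [lc Hc], (exist_sin (- d ^ 2)) as [ls Hs].
destruct (cosh_sinh_series d lc ls Hc Hs) as [-> _].
apply is_series_Reals in Hc; rewrite <- (is_series_unique _ _ Hc).
apply Series_ext; intro n.
unfold cos_n; rewrite pow_mult; unfold curvature, Rdiv.
replace (- d ^ 2) with (-1 * d ^ 2) by ring.
rewrite Rpow_mult_distr.
(* One sign [(-1) ^ n] comes from [cos_n], the other from the argument [- d ^ 2]; the base is split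
   to match them. *)
replace (- -1) with (-1 * -1) by ring; rewrite Rpow_mult_distr; ring.
Qed.

Lemma gen_sin_hyperbolic (d : R) : gen_sin Hyperbolic d = sinh d.
Proof.
destruct (exist_cos (- d ^ 2)) as [lc Hc], (exist_sin (- d ^ 2)) as [ls Hs].
destruct (cosh_sinh_series d lc ls Hc Hs) as [_ ->].
apply is_series_Reals in Hs; rewrite <- (is_series_unique _ _ Hs), <- Series_scal_l.
apply Series_ext; intro n.
unfold sin_n; rewrite pow_add, pow_mult; unfold curvature, Rdiv.
replace (- d ^ 2) with (-1 * d ^ 2) by ring.
rewrite Rpow_mult_distr.
replace (- -1) with (-1 * -1) by ring; rewrite Rpow_mult_distr, pow_1; ring.
Qed.

(** * Subtraction formulas, quadratic identity, values at 0 and derivative *)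

Lemma cosh_sinh_pow2 (x : R) : cosh x ^ 2 = 1 + sinh x ^ 2.
Proof.
assert (H : exp x * exp (- x) = 1) by (rewrite <- exp_plus, Rplus_opp_r; apply exp_0).
unfold cosh, sinh; nra.
Qed.

Lemma sinh_minus (x y : R) : sinh (x - y) = sinh x * cosh y - cosh x * sinh y.
Proof.
unfold sinh, cosh; replace (- (x - y)) with (- x + y) by ring.
replace (x - y) with (x + - y) by ring; rewrite !exp_plus; field.
Qed.

Lemma cosh_minus (x y : R) : cosh (x - y) = cosh x * cosh y - sinh x * sinh y.
Proof.
unfold sinh, cosh; replace (- (x - y)) with (- x + y) by ring.
replace (x - y) with (x + - y) by ring; rewrite !exp_plus; field.
Qed.

(** [cosh] determines [sinh ^ 2], hence [sinh] where it is nonnegative, and [sinh] has the left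
    inverse [arcsinh]. *)
Lemma cosh_inj (x y : R) : 0 <= x -> 0 <= y -> cosh x = cosh y -> x = y.
Proof.
intros Hx Hy H.
assert (Hs : (sinh x - sinh y) * (sinh x + sinh y) = 0).
{ pose proof (cosh_sinh_pow2 x); pose proof (cosh_sinh_pow2 y); rewrite H in *; nra. }
assert (Hp : forall z, 0 <= z -> 0 <= sinh z).
{ intros z [Hz|<-]; [|rewrite sinh_0; lra].
  apply sinh_lt in Hz; rewrite sinh_0 in Hz; lra. }
assert (E : sinh x = sinh y).
{ pose proof (Hp x Hx); pose proof (Hp y Hy).
  apply Rmult_integral in Hs; lra. }
rewrite <- (arcsinh_sinh x), E; apply arcsinh_sinh.
Qed.

Lemma gen_sin_minus (X : geometry) (x y : R) :
  gen_sin X (x - y) = gen_sin X x * gen_cos X y - gen_cos X x * gen_sin X y.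
Proof.
destruct X.
- rewrite !gen_sin_euclidean, !gen_cos_euclidean; ring.
- rewrite !gen_sin_spherical, !gen_cos_spherical; apply sin_minus.
- rewrite !gen_sin_hyperbolic, !gen_cos_hyperbolic; apply sinh_minus.
Qed.

Lemma gen_cos_minus (X : geometry) (x y : R) :
  gen_cos X (x - y) =
    gen_cos X x * gen_cos X y + curvature X * (gen_sin X x * gen_sin X y).
Proof.
destruct X.
- rewrite !gen_sin_euclidean, !gen_cos_euclidean; simpl; ring.
- rewrite !gen_sin_spherical, !gen_cos_spherical, cos_minus; simpl; ring.
- rewrite !gen_sin_hyperbolic, !gen_cos_hyperbolic, cosh_minus; simpl; ring.
Qed.

Lemma gen_cos_sin_pow2 (X : geometry) (x : R) :
  gen_cos X x ^ 2 + curvature X * gen_sin X x ^ 2 = 1.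
Proof.
destruct X.
- rewrite gen_cos_euclidean; simpl; ring.
- rewrite gen_sin_spherical, gen_cos_spherical.
  pose proof (sin2_cos2 x) as H; unfold Rsqr in H; simpl; lra.
- rewrite gen_sin_hyperbolic, gen_cos_hyperbolic, cosh_sinh_pow2; simpl; ring.
Qed.

Lemma gen_sin_0 (X : geometry) : gen_sin X 0 = 0.
Proof.
destruct X.
- apply gen_sin_euclidean.
- rewrite gen_sin_spherical; apply sin_0.
- rewrite gen_sin_hyperbolic; apply sinh_0.
Qed.

Lemma gen_cos_0 (X : geometry) : gen_cos X 0 = 1.
Proof.
destruct X.
- apply gen_cos_euclidean.
- rewrite gen_cos_spherical; apply cos_0.
- rewrite gen_cos_hyperbolic; apply cosh_0.
Qed.

Lemma is_derive_gen_sin (X : geometry) (x : R) :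
  is_derive (gen_sin X) x (gen_cos X x).
Proof.
destruct X.
- rewrite gen_cos_euclidean.
  apply (is_derive_ext (fun t => t)); [intro; symmetry; apply gen_sin_euclidean|].
  apply @is_derive_id.
- rewrite gen_cos_spherical.
  apply (is_derive_ext sin); [intro; symmetry; apply gen_sin_spherical|].
  apply is_derive_Reals, derivable_pt_lim_sin.
- rewrite gen_cos_hyperbolic.
  apply (is_derive_ext sinh); [intro; symmetry; apply gen_sin_hyperbolic|].
  apply is_derive_Reals, derivable_pt_lim_sinh.
Qed.

(** * The ambient form and coincidence of points on the quadric *)

Definition lincomb (a : R) (p : point) (b : R) (q : point) : point :=
  let '(p1, p2, p3) := p in let '(q1, q2, q3) := q in
  (a * p1 + b * q1, a * p2 + b * q2, a * p3 + b * q3).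

Lemma metric_sym (X : geometry) (p q : point) : metric X p q = metric X q p.
Proof.
destruct p as [[p1 p2] p3], q as [[q1 q2] q3]; destruct X; simpl; ring.
Qed.

Lemma metric_lincomb_l (X : geometry) (a b : R) (p q r : point) :
  metric X (lincomb a p b q) r = a * metric X p r + b * metric X q r.
Proof.
destruct p as [[p1 p2] p3], q as [[q1 q2] q3], r as [[r1 r2] r3].
destruct X; simpl; ring.
Qed.

Lemma metric_lincomb_r (X : geometry) (a b : R) (p q r : point) :
  metric X r (lincomb a p b q) = a * metric X r p + b * metric X r q.
Proof. now rewrite metric_sym, metric_lincomb_l, !(metric_sym X r). Qed.

Lemma sum_sq_eq0 (x y : R) : x ^ 2 + y ^ 2 = 0 -> x = 0 /\ y = 0.
Proof.
intro H; pose proof (pow2_ge_0 x); pose proof (pow2_ge_0 y).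
split; apply Rsqr_0_uniq; rewrite Rsqr_pow2; lra.
Qed.

Lemma dot_self_eq0 (p : point) : dot p p = 0 -> p = (0, 0, 0).
Proof.
destruct p as [[x y] z]; simpl; intro H.
(* The square root packs two squares into one, so that the two-term lemma applies. *)
destruct (sum_sq_eq0 x (sqrt (y ^ 2 + z ^ 2))) as [-> _].
{ rewrite pow2_sqrt by nra; lra. }
destruct (sum_sq_eq0 y z) as [-> ->]; [lra|reflexivity].
Qed.

(* The orthogonal complement of a timelike vector is positive definite. *)
Lemma lorentz_null_orthogonal (p w : point) :
  lorentz p p = -1 -> lorentz p w = 0 -> lorentz w w = 0 -> w = (0, 0, 0).
Proof.
destruct p as [[x y] z], w as [[u v] s]; simpl; intros Hp Hpw Hw.
(* Lagrange's identity for [(x, y)] and [(u, v)], with [u^2 + v^2 = s^2], [x u + y v = z s] and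
   [z^2 = x^2 + y^2 + 1] substituted. *)
assert (E : s ^ 2 + (u * y - v * x) ^ 2 = 0).
{ replace (s ^ 2 + (u * y - v * x) ^ 2) with
    ((u * u + v * v - s * s) * (x * x + y * y)
     + s ^ 2 * (x * x + y * y - z * z + 1)
     - (x * u + y * v - z * s) * (x * u + y * v + z * s)) by ring.
  rewrite Hw, Hpw; replace (x * x + y * y - z * z + 1) with 0 by lra; ring. }
apply sum_sq_eq0 in E; destruct E as [-> _].
destruct (sum_sq_eq0 u v) as [-> ->]; [lra|reflexivity].
Qed.

Lemma lincomb_sub_eq0 (p q : point) : lincomb 1 p (-1) q = (0, 0, 0) -> p = q.
Proof.
destruct p as [[p1 p2] p3], q as [[q1 q2] q3]; simpl; intro H.
injection H; intros; repeat f_equal; lra.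
Qed.

(** The difference [p - q] is null and orthogonal to [p]. On the sphere the form is definite; in the
    hyperbolic case it is definite on the complement of the timelike [p]. Either way the difference
    vanishes. *)
Lemma quadric_eq (X : geometry) (p q : point) :
  X <> Euclidean -> metric X p p = curvature X -> metric X q q = curvature X ->
  metric X p q = curvature X -> p = q.
Proof.
intros HX Hp Hq Hpq; apply lincomb_sub_eq0.
assert (Hw : metric X (lincomb 1 p (-1) q) (lincomb 1 p (-1) q) = 0).
{ rewrite metric_lincomb_l, !metric_lincomb_r, (metric_sym X q p), Hp, Hq, Hpq.
  ring. }
destruct X; [easy|now apply dot_self_eq0|].
apply lorentz_null_orthogonal with p; [exact Hp| |exact Hw].
change (metric Hyperbolic p (lincomb 1 p (-1) q) = 0).
rewrite metric_lincomb_r, Hp, Hpq; ring.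
Qed.

(** * Distances in terms of the form, and their uniqueness *)

Lemma metric_self (X : geometry) (p : point) :
  X <> Euclidean -> on_space X p -> metric X p p = curvature X.
Proof.
destruct p as [[x y] z]; destruct X; simpl; intros HX Hp; [easy|lra|lra].
Qed.

Lemma metric_distance (X : geometry) (p q : point) (d : R) :
  X <> Euclidean -> is_distance X p q d ->
  metric X p q = curvature X * gen_cos X d.
Proof.
destruct p as [[p1 p2] p3], q as [[q1 q2] q3]; destruct X; simpl; intros HX H.
- easy.
- rewrite gen_cos_spherical; lra.
- rewrite gen_cos_hyperbolic; lra.
Qed.

Lemma euclidean_distance_sq (p q : point) (d : R) :
  is_distance Euclidean p q d ->
  dot (lincomb 1 p (-1) q) (lincomb 1 p (-1) q) = d ^ 2.
Proof.
destruct p as [[p1 p2] p3], q as [[q1 q2] q3]; intros ->.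
pose proof (pow2_ge_0 (p1 - q1)); pose proof (pow2_ge_0 (p2 - q2)).
pose proof (pow2_ge_0 (p3 - q3)).
rewrite pow2_sqrt by lra; simpl; ring.
Qed.

Lemma is_distance_sym (X : geometry) (p q : point) (d : R) :
  is_distance X p q d -> is_distance X q p d.
Proof.
destruct p as [[p1 p2] p3], q as [[q1 q2] q3]; destruct X; simpl; intro H.
- rewrite H; f_equal; ring.
- lra.
- lra.
Qed.

Lemma is_distance_unique (X : geometry) (p q : point) (d d' : R) :
  is_distance X p q d -> is_distance X p q d' -> d = d'.
Proof.
destruct p as [[p1 p2] p3], q as [[q1 q2] q3]; destruct X; simpl;
  intros H H'.
- now rewrite H, H'.
- apply cos_inj; lra.
- apply cosh_inj; lra.
Qed.

(** * Non-degeneracy of the sides of a triangle *)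

(** The cross product serves when it is nonzero. Otherwise [q] is a multiple of [p], and any nonzero
    vector orthogonal to [p] will do. *)
Lemma orthogonal_exists (p q : point) :
  p <> (0, 0, 0) -> exists n, n <> (0, 0, 0) /\ dot n p = 0 /\ dot n q = 0.
Proof.
destruct p as [[x y] z], q as [[u v] w]; intro Hp.
destruct (Req_dec (y * w - z * v) 0) as [H1|H1];
  [|exists (y * w - z * v, z * u - x * w, x * v - y * u); simpl;
    split; [intro E; injection E; lra|split; ring]].
destruct (Req_dec (z * u - x * w) 0) as [H2|H2];
  [|exists (y * w - z * v, z * u - x * w, x * v - y * u); simpl;
    split; [intro E; injection E; lra|split; ring]].
destruct (Req_dec (x * v - y * u) 0) as [H3|H3];
  [|exists (y * w - z * v, z * u - x * w, x * v - y * u); simpl;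
    split; [intro E; injection E; lra|split; ring]].
destruct (Req_dec x 0) as [Hx|Hx].
- destruct (Req_dec y 0) as [Hy|Hy].
  + subst x y; assert (Hz : z <> 0) by (intros ->; now apply Hp).
    exists (1, 0, 0); simpl; split; [intro E; injection E; lra|].
    split; [ring|].
    assert (E : z * u = 0) by lra; apply Rmult_integral in E; lra.
  + exists (- y, x, 0); simpl; split; [intro E; injection E; lra|split; lra].
- exists (- y, x, 0); simpl; split; [intro E; injection E; lra|split; lra].
Qed.

Lemma on_space_neq0 (X : geometry) (p : point) : on_space X p -> p <> (0, 0, 0).
Proof. intros H ->; destruct X; simpl in H; lra. Qed.

(** [lincomb k p 0 p] is the multiple [k p]: [k = 1] covers coinciding vertices, [k = -1] antipodal
    ones. *)
Lemma parallel_collinear (k : R) (p q r : point) :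
  p <> (0, 0, 0) -> q = lincomb k p 0 p -> collinear p q r.
Proof.
intros Hp ->; destruct (orthogonal_exists p r Hp) as (n & Hn & Hnp & Hnr).
exists n; repeat split; trivial.
change (metric Spherical n (lincomb k p 0 p) = 0).
rewrite metric_lincomb_r; simpl; rewrite Hnp; ring.
Qed.

(** In the curved case a zero sine forces the cosine to be 1 or -1, and [quadric_eq] then gives
    [q = p] or [q = - p]; in the plane it forces [d = 0]. Each outcome contradicts
    non-collinearity. *)
Lemma gen_sin_distance_neq0 (X : geometry) (p q r : point) (d : R) :
  is_triangle X p q r -> is_distance X p q d -> gen_sin X d <> 0.
Proof.
intros (Hp & Hq & _ & Hncol) Hd Hs; apply Hncol.
pose proof (on_space_neq0 _ _ Hp) as Hp0.
assert (Heq : p = q -> collinear p q r).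
{ intros <-; apply parallel_collinear with 1; [exact Hp0|].
  destruct p as [[x y] z]; simpl; repeat f_equal; ring. }
assert (HX : X = Euclidean \/ X <> Euclidean)
  by (destruct X; [left|right|right]; easy).
destruct HX as [->|HX].
- rewrite gen_sin_euclidean in Hs; subst d.
  apply Heq, lincomb_sub_eq0, dot_self_eq0.
  rewrite (euclidean_distance_sq _ _ _ Hd); ring.
- pose proof (metric_self X p HX Hp) as Hpp.
  pose proof (metric_self X q HX Hq) as Hqq.
  pose proof (metric_distance X p q d HX Hd) as Hpq.
  pose proof (gen_cos_sin_pow2 X d) as H1; rewrite Hs in H1.
  assert (Hc : (gen_cos X d - 1) * (gen_cos X d + 1) = 0) by lra.
  apply Rmult_integral in Hc; destruct Hc as [Hc|Hc].
  + apply Heq, (quadric_eq X); trivial.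
    rewrite Hpq; replace (gen_cos X d) with 1 by lra; ring.
  + apply parallel_collinear with (-1); [exact Hp0|].
    symmetry; apply (quadric_eq X); trivial;
      rewrite ?metric_lincomb_l, ?metric_lincomb_r, ?Hpp, ?Hpq;
      [|replace (gen_cos X d) with (-1) by lra]; ring.
Qed.

(** * Geodesic segments and their initial velocities *)

Lemma segment_point (X : geometry) (p q : point) (L : R) (g : R -> point)
    (t : R) :
  gen_sin X L <> 0 -> is_segment X p q L g -> 0 <= t <= L ->
  g t = lincomb (gen_sin X (L - t) / gen_sin X L) p
          (gen_sin X t / gen_sin X L) q.
Proof.
intros HsL (HL & Hg0 & HgL & Hon & Hdist) Ht.
assert (Hpq := Hdist 0 L ltac:(lra) ltac:(lra)).
assert (Hpt := Hdist 0 t ltac:(lra) Ht).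
assert (Hqt := Hdist L t ltac:(lra) Ht).
rewrite Hg0 in Hpq, Hpt; rewrite HgL in Hpq, Hqt.
rewrite Rabs_left1 in Hpq, Hpt by lra; rewrite Rabs_pos_eq in Hqt by lra.
replace (- (0 - L)) with L in Hpq by ring.
replace (- (0 - t)) with t in Hpt by ring.
assert (HX : X = Euclidean \/ X <> Euclidean)
  by (destruct X; [left|right|right]; easy).
destruct HX as [->|HX].
- rewrite gen_sin_euclidean in *.
  apply euclidean_distance_sq in Hpq, Hpt, Hqt.
  rewrite !gen_sin_euclidean.
  set (x := lincomb _ p _ q).
  (* Stewart's theorem for the point [x] dividing [p q] in the ratio [t : L - t]. With the distances
     [t], [L - t] and [L] inserted, the right side is 0. *)
  assert (Hx : dot (lincomb 1 (g t) (-1) x) (lincomb 1 (g t) (-1) x) =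
    (L - t) / L * dot (lincomb 1 p (-1) (g t)) (lincomb 1 p (-1) (g t))
    + t / L * dot (lincomb 1 q (-1) (g t)) (lincomb 1 q (-1) (g t))
    - (L - t) * t / L ^ 2 * dot (lincomb 1 p (-1) q) (lincomb 1 p (-1) q)).
  { unfold x; destruct p as [[p1 p2] p3], q as [[q1 q2] q3], (g t) as [[g1 g2] g3].
    simpl; field; exact HsL. }
  apply lincomb_sub_eq0, dot_self_eq0.
  rewrite Hx, Hpq, Hpt, Hqt; field; exact HsL.
- assert (H0 : 0 <= 0 <= L) by lra.
  assert (HLL : 0 <= L <= L) by lra.
  pose proof (Hon 0 H0) as Hpp; pose proof (Hon L HLL) as Hqq.
  rewrite Hg0 in Hpp; rewrite HgL in Hqq.
  apply (metric_self X _ HX) in Hpp, Hqq.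
  pose proof (metric_self X _ HX (Hon t Ht)) as Hgg.
  apply (metric_distance X _ _ _ HX) in Hpq, Hpt, Hqt.
  pose proof (gen_cos_sin_pow2 X L) as EL; pose proof (gen_cos_sin_pow2 X t) as Et.
  rewrite gen_cos_minus in Hqt.
  apply (quadric_eq X); trivial;
    rewrite ?metric_lincomb_l, ?metric_lincomb_r, ?(metric_sym X (g t)),
      ?(metric_sym X q p), ?Hpp, ?Hqq, ?Hpq, ?Hpt, ?Hqt, gen_sin_minus;
    set (sL := gen_sin X L) in *; set (cL := gen_cos X L) in *;
    set (st := gen_sin X t) in *; set (ct := gen_cos X t) in *.
  (* Both products reduce to [k (ct^2 + k st^2) = k]; in this one [1 - cL^2] must first be
     recognised as [k sL^2]. *)
  + transitivity (curvature X * (sL ^ 2 * ct ^ 2 + (1 - cL ^ 2) * st ^ 2) / sL ^ 2);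
      [field; exact HsL|].
    replace (1 - cL ^ 2) with (curvature X * sL ^ 2) by lra.
    transitivity (curvature X * (ct ^ 2 + curvature X * st ^ 2));
      [field; exact HsL|rewrite Et; ring].
  + transitivity (curvature X * (ct ^ 2 + curvature X * st ^ 2));
      [field; exact HsL|rewrite Et; ring].
Qed.

(** [pi] stands for a coordinate. The difference quotient of [f] tends from the right both to
    [pi u], since [f] agrees with [pi] of [g] on [[0, L]], and to the two-sided derivative [l];
    limits are unique. *)
Lemma initial_velocity_coord (pi : point -> R) (g : R -> point) (u : point)
    (L : R) (f : R -> R) (l : R) :
  (forall x, continuous pi x) ->
  (forall k x y, pi (scal k (minus x y)) = k * (pi x - pi y)) ->
  0 < L -> (forall t, 0 <= t <= L -> pi (g t) = f t) ->
  is_derive f 0 l -> initial_velocity g u -> pi u = l.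
Proof.
intros Hcont Hlin HL Hf Hl Hu.
apply (filterlim_locally_unique (F := at_right 0) (fun t => (f t - f 0) / t)).
- apply filterlim_ext_loc with (fun t => pi (scal (/ t) (minus (g t) (g 0)))).
  + exists (mkposreal L HL); intros t Ht Ht0.
    unfold ball in Ht; simpl in Ht; unfold AbsRing_ball, abs, minus, plus, opp in Ht;
      simpl in Ht.
    apply Rabs_def2 in Ht.
    rewrite Hlin, !Hf by lra; unfold Rdiv; ring.
  + eapply filterlim_comp; [exact Hu|apply Hcont].
- apply is_derive_Reals in Hl; apply filterlim_locally; intro eps.
  destruct (Hl eps (cond_pos eps)) as [delta Hd].
  exists delta; intros t Ht Ht0.
  unfold ball in *; simpl in *; unfold AbsRing_ball, abs, minus, plus, opp in *;
    simpl in *.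
  replace (t + - 0) with t in Ht by ring.
  specialize (Hd t ltac:(lra) Ht); now rewrite Rplus_0_l in Hd.
Qed.

Lemma segment_initial_velocity (X : geometry) (p q : point) (L : R)
    (g : R -> point) (u : point) :
  gen_sin X L <> 0 -> is_segment X p q L g -> initial_velocity g u ->
  u = lincomb (- (gen_cos X L / gen_sin X L)) p (/ gen_sin X L) q.
Proof.
intros HsL Hg Hu.
assert (HL : 0 < L).
{ destruct Hg as ([HL|<-] & _); [exact HL|now rewrite gen_sin_0 in HsL]. }
assert (Hpt := fun t => segment_point X p q L g t HsL Hg).
assert (Hder : forall x y, is_derive (fun t => gen_sin X (L - t) / gen_sin X L * x
    + gen_sin X t / gen_sin X L * y) 0
    (- (gen_cos X L / gen_sin X L) * x + / gen_sin X L * y)).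
{ intros x y.
  auto_derive.
  - repeat split; eexists; apply is_derive_gen_sin.
  - rewrite !(is_derive_unique _ _ _ (is_derive_gen_sin X _)), gen_cos_0.
    replace (L + - 0) with L by ring; field; exact HsL. }
(* An abstract continuous linear coordinate lets the limit argument run once for all three
   projections. *)
assert (C : forall (pi : point -> R),
  (forall x, continuous pi x) ->
  (forall k x y, pi (scal k (minus x y)) = k * (pi x - pi y)) ->
  (forall a x b y, pi (lincomb a x b y) = a * pi x + b * pi y) ->
  pi u = pi (lincomb (- (gen_cos X L / gen_sin X L)) p (/ gen_sin X L) q)).
{ intros pi Hc Hl Hl'; rewrite Hl'.
  eapply (initial_velocity_coord pi g u L _ _ Hc Hl HL); [|apply Hder|exact Hu].
  intros t Ht; rewrite (Hpt t Ht); apply Hl'. }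
pose proof (C (fun x => fst (fst x))) as C1.
pose proof (C (fun x => snd (fst x))) as C2.
pose proof (C snd) as C3.
destruct (lincomb _ p _ q) as [[w1 w2] w3], u as [[u1 u2] u3]; simpl in *.
repeat f_equal.
- apply C1.
  + intros [[x1 x2] x3]; apply (continuous_comp fst fst); apply continuous_fst.
  + intros k [[x1 x2] x3] [[y1 y2] y3]; reflexivity.
  + intros a [[x1 x2] x3] b [[y1 y2] y3]; reflexivity.
- apply C2.
  + intros [[x1 x2] x3]; apply (continuous_comp fst snd);
      [apply continuous_fst|apply continuous_snd].
  + intros k [[x1 x2] x3] [[y1 y2] y3]; reflexivity.
  + intros a [[x1 x2] x3] b [[y1 y2] y3]; reflexivity.
- apply C3.
  + intros [[x1 x2] x3]; apply continuous_snd.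
  + intros k [[x1 x2] x3] [[y1 y2] y3]; reflexivity.
  + intros a [[x1 x2] x3] b [[y1 y2] y3]; reflexivity.
Qed.

(** * The law of cosines at one vertex, then at all three by rotation *)

Lemma is_triangle_rot (X : geometry) (p q r : point) :
  is_triangle X p q r -> is_triangle X q r p.
Proof.
intros (Hp & Hq & Hr & Hn); repeat split; trivial.
intros (n & Hn0 & H1 & H2 & H3); apply Hn; now exists n.
Qed.

Lemma is_segment_distance (X : geometry) (p q : point) (L : R) (g : R -> point) :
  is_segment X p q L g -> is_distance X p q L.
Proof.
intros (HL & <- & H & _ & Hd); rewrite <- H at 1.
specialize (Hd 0 L ltac:(lra) ltac:(lra)).
rewrite Rabs_left1 in Hd by lra.
now replace (- (0 - L)) with L in Hd by ring.
Qed.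

Lemma gen_law_of_cosines (X : geometry) (p q r : point) (a b c theta : R) :
  is_triangle X p q r -> is_distance X q r a -> is_distance X r p b ->
  is_distance X p q c -> is_angle X p q r theta ->
  t_coef X b c a * gen_sin X a ^ 2 =
    t_coef X c a b * gen_sin X b ^ 2 + t_coef X a b c * gen_sin X c ^ 2
    - 2 * gen_sin X b * gen_sin X c * cos theta.
Proof.
intros HT Ha Hb Hc (L & M & g & h & u & v & Hg & Hh & Hu & Hv & _ & Hcos).
(* The segments witnessing the angle bring their own lengths, which uniqueness of distance
   identifies with the sides. *)
assert (EL : L = c)
  by exact (is_distance_unique _ _ _ _ _ (is_segment_distance _ _ _ _ _ Hg) Hc).
assert (EM : M = b)
  by exact (is_distance_unique _ _ _ _ _ (is_segment_distance _ _ _ _ _ Hh)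
    (is_distance_sym _ _ _ _ Hb)).
subst L M.
pose proof (gen_sin_distance_neq0 _ _ _ _ _ HT Hc) as Sc.
pose proof (gen_sin_distance_neq0 _ _ _ _ _ (is_triangle_rot _ _ _ _ HT) Ha) as Sa.
pose proof (gen_sin_distance_neq0 _ _ _ _ _
  (is_triangle_rot _ _ _ _ (is_triangle_rot _ _ _ _ HT)) Hb) as Sb.
rewrite (segment_initial_velocity _ _ _ _ _ _ Sc Hg Hu),
  (segment_initial_velocity _ _ _ _ _ _ Sb Hh Hv) in Hcos.
destruct HT as (Hp & Hq & Hr & _).
assert (HX : X = Euclidean \/ X <> Euclidean)
  by (destruct X; [left|right|right]; easy).
destruct HX as [->|HX].
- unfold t_coef; rewrite !gen_sin_euclidean, !gen_cos_euclidean in *.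
  apply euclidean_distance_sq in Ha, Hb, Hc.
  set (w := lincomb _ p _ q) in Hcos; set (z := lincomb _ p _ r) in Hcos.
  assert (Hww : metric Euclidean w w =
    dot (lincomb 1 p (-1) q) (lincomb 1 p (-1) q) / c ^ 2).
  { unfold w; destruct p as [[p1 p2] p3], q as [[q1 q2] q3].
    simpl; field; exact Sc. }
  assert (Hzz : metric Euclidean z z =
    dot (lincomb 1 r (-1) p) (lincomb 1 r (-1) p) / b ^ 2).
  { unfold z; destruct p as [[p1 p2] p3], r as [[r1 r2] r3].
    simpl; field; exact Sb. }
  (* Polarisation: [w] is [(q - p) / c], [z] is [(r - p) / b], and the difference of [q - p] and
     [r - p] is the third side. *)
  assert (Hwz : metric Euclidean w z =
    (dot (lincomb 1 p (-1) q) (lincomb 1 p (-1) q)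
     + dot (lincomb 1 r (-1) p) (lincomb 1 r (-1) p)
     - dot (lincomb 1 q (-1) r) (lincomb 1 q (-1) r)) / (2 * b * c)).
  { unfold w, z; destruct p as [[p1 p2] p3], q as [[q1 q2] q3], r as [[r1 r2] r3].
    simpl; field; split; assumption. }
  rewrite Hc in Hww; rewrite Hb in Hzz; rewrite Ha, Hb, Hc in Hwz.
  replace (c ^ 2 / c ^ 2) with 1 in Hww by (field; exact Sc).
  replace (b ^ 2 / b ^ 2) with 1 in Hzz by (field; exact Sb).
  rewrite Hcos, Hww, Hzz, Hwz, sqrt_1; field; split; assumption.
- apply (metric_self X _ HX) in Hp, Hq, Hr.
  apply (metric_distance X _ _ _ HX) in Ha, Hb, Hc.
  rewrite (metric_sym X r p) in Hb.
  assert (K2 : curvature X ^ 2 = 1) by (destruct X; [easy|simpl; ring|simpl; ring]).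
  assert (K0 : curvature X <> 0) by (intro E; rewrite E in K2; simpl in K2; lra).
  pose proof (gen_cos_sin_pow2 X a) as Ea.
  pose proof (gen_cos_sin_pow2 X b) as Eb.
  pose proof (gen_cos_sin_pow2 X c) as Ec.
  rewrite ?metric_lincomb_l, ?metric_lincomb_r, ?(metric_sym X q p),
    ?(metric_sym X r p), ?Hp, ?Hq, ?Hr, ?Ha, ?Hb, ?Hc in Hcos.
  unfold t_coef.
  set (k := curvature X) in *.
  set (sa := gen_sin X a) in *; set (ca := gen_cos X a) in *.
  set (sb := gen_sin X b) in *; set (cb := gen_cos X b) in *.
  set (sc := gen_sin X c) in *; set (cc := gen_cos X c) in *.
  (* Since [k ^ 2 = 1], each squared sine contains the denominator of its coefficient as a
     factor. *)
  assert (U : forall s x, s <> 0 -> x ^ 2 + k * s ^ 2 = 1 ->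
    1 + x <> 0 /\ s ^ 2 = k * (1 - x) * (1 + x)).
  { intros s x Hs E; split.
    - intro H; replace x with (-1) in E by lra.
      assert (E0 : k * s ^ 2 = 0) by lra.
      apply Rmult_integral in E0; destruct E0 as [E0|E0]; [now apply K0|].
      now apply (pow_nonzero s 2 Hs).
    - replace (k * (1 - x) * (1 + x)) with (k * (1 - x ^ 2)) by ring.
      replace (1 - x ^ 2) with (k * s ^ 2) by lra.
      replace (k * (k * s ^ 2)) with (k ^ 2 * s ^ 2) by ring; rewrite K2; ring. }
  (* The square norm of an initial velocity, in the shape left by bilinear expansion. *)
  assert (N : forall s x, s <> 0 -> x ^ 2 + k * s ^ 2 = 1 ->
    - (x / s) * (- (x / s) * k + / s * (k * x))
    + / s * (- (x / s) * (k * x) + / s * k) = 1).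
  { intros s x Hs E.
    transitivity (k * (1 - x ^ 2) / s ^ 2); [field; exact Hs|].
    replace (1 - x ^ 2) with (k * s ^ 2) by lra.
    transitivity (k ^ 2); [field; exact Hs|exact K2]. }
  rewrite (N sc cc Sc Ec), (N sb cb Sb Eb), sqrt_1 in Hcos.
  assert (Hcos' : sb * sc * cos theta = k * (ca - cb * cc)).
  { rewrite Hcos; field; split; assumption. }
  destruct (U sa ca Sa Ea) as [Na ->], (U sb cb Sb Eb) as [Nb ->],
    (U sc cc Sc Ec) as [Nc ->].
  replace (2 * sb * sc * cos theta) with (2 * (k * (ca - cb * cc)))
    by (rewrite <- Hcos'; ring).
  (* After cancellation both sides equal [k (cb + cc) (1 - ca)]. *)
  field; repeat split; assumption.
Qed.

Theorem mainTheorem1 (X : geometry) (vA vB vC : point) (a b c A B C : R)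
    (hT : is_triangle X vA vB vC)
    (ha : is_distance X vB vC a)
    (hb : is_distance X vC vA b)
    (hc : is_distance X vA vB c)
    (hA : is_angle X vA vB vC A)
    (hB : is_angle X vB vC vA B)
    (hC : is_angle X vC vA vB C) :
  (t_coef X b c a * (gen_sin X a) ^ 2 =
     t_coef X c a b * (gen_sin X b) ^ 2 + t_coef X a b c * (gen_sin X c) ^ 2
     - 2 * gen_sin X b * gen_sin X c * cos A) /\
  (t_coef X c a b * (gen_sin X b) ^ 2 =
     t_coef X a b c * (gen_sin X c) ^ 2 + t_coef X b c a * (gen_sin X a) ^ 2
     - 2 * gen_sin X c * gen_sin X a * cos B) /\
  (t_coef X a b c * (gen_sin X c) ^ 2 =
     t_coef X b c a * (gen_sin X a) ^ 2 + t_coef X c a b * (gen_sin X b) ^ 2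
     - 2 * gen_sin X a * gen_sin X b * cos C) /\
  (A = PI / 2 ->
     t_coef X b c a * (gen_sin X a) ^ 2 =
       t_coef X c a b * (gen_sin X b) ^ 2 + t_coef X a b c * (gen_sin X c) ^ 2).
Proof.
assert (HT' := is_triangle_rot _ _ _ _ hT).
assert (HT'' := is_triangle_rot _ _ _ _ HT').
assert (LA := gen_law_of_cosines X vA vB vC a b c A hT ha hb hc hA).
repeat split.
- exact LA.
- exact (gen_law_of_cosines X vB vC vA b c a B HT' hb hc ha hB).
- exact (gen_law_of_cosines X vC vA vB c a b C HT'' hc ha hb hC).
- intros ->; rewrite LA, cos_PI2; ring.
Qed.
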